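(* Let $G$ be a Hamiltonian graph. Then $G\mathbin{\square}K_2$ is Hamiltonian-transitive if and only if $G$ is isomorphic to $C_k$ for some odd $k\ge 3$, or $G$ is isomorphic to $C_4$.
   Context: All graphs are finite, simple and undirected. A Hamiltonian cycle is a cycle (of length at least 3) through all vertices, identified with its edge set; a graph is Hamiltonian if it has one. A graph is Hamiltonian-transitive if it is Hamiltonian and for every pair of Hamiltonian cycles there is an automorphism of the graph mapping one to the other. The Cartesian product $G\mathbin{\square}H$ has vertex set $V(G)\times V(H)$, with $(g,h)$ and $(g',h')$ adjacent iff ($g=g'$ and $\{h,h'\}\in E(H)$) or ($h=h'$ and $\{g,g'\}\in E(G)$). $K_2$ is the complete graph on 2 vertices, $C_k$ the cycle on $k$ vertices. *)

(* Defs.v *)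
From mathcomp Require Import all_boot.

Set Implicit Arguments.
Unset Strict Implicit.
Unset Printing Implicit Defensive.

Record sgraph := SGraph {
  vertex :> finType;
  adj : rel vertex;
  adj_sym : symmetric adj;
  adj_irrefl : irreflexive adj
}.

Definition is_isomorphism (G H : sgraph) (f : G -> H) : Prop :=
  bijective f /\ forall x y : G, adj (f x) (f y) = adj x y.

Definition isomorphic (G H : sgraph) : Prop :=
  exists f : G -> H, is_isomorphism f.

Definition is_automorphism (G : sgraph) (f : G -> G) : Prop :=
  is_isomorphism f.

Definition cycle_edges (G : sgraph) (s : seq G) : {set {set G}} :=
  [set [set x; next s x] | x in s].

(* A Hamiltonian cycle is its set of edges [C], an edge being a two-element
   vertex set; [s] lists the vertices in cyclic order from some starting point. *)
Definition hamiltonian_cycle (G : sgraph) (C : {set {set G}}) : Prop :=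
  exists s : seq G,
    [/\ ucycle (@adj G) s, 3 <= size s, forall x : G, x \in s
      & C = cycle_edges s].

Definition hamiltonian (G : sgraph) : Prop :=
  exists C : {set {set G}}, hamiltonian_cycle C.

Definition edge_image (G H : sgraph) (f : G -> H) (C : {set {set G}}) :
    {set {set H}} :=
  [set f @: (e : {set G}) | e in C].

Definition hamiltonian_transitive (G : sgraph) : Prop :=
  hamiltonian G /\
  forall C D : {set {set G}}, hamiltonian_cycle C -> hamiltonian_cycle D ->
    exists f : G -> G, is_automorphism f /\ edge_image f C = D.

Section CartesianProduct.
Variables G H : sgraph.

Definition cart_adj : rel (G * H) := fun u v =>
  ((u.1 == v.1) && adj u.2 v.2) || ((u.2 == v.2) && adj u.1 v.1).

Lemma cart_adj_sym : symmetric cart_adj.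
Proof.
move=> u v; rewrite /cart_adj.
by rewrite [u.1 == _]eq_sym [u.2 == _]eq_sym (adj_sym u.1) (adj_sym u.2).
Qed.

Lemma cart_adj_irrefl : irreflexive cart_adj.
Proof. by move=> u; rewrite /cart_adj !adj_irrefl !andbF. Qed.

Definition cart_prod : sgraph := SGraph cart_adj_sym cart_adj_irrefl.

End CartesianProduct.

Section CompleteGraph.
Variable n : nat.

Definition complete_adj : rel 'I_n := fun i j => i != j.

Lemma complete_adj_sym : symmetric complete_adj.
Proof. by move=> i j; rewrite /complete_adj eq_sym. Qed.

Lemma complete_adj_irrefl : irreflexive complete_adj.
Proof. by move=> i; rewrite /complete_adj eqxx. Qed.

Definition complete_graph : sgraph :=
  SGraph complete_adj_sym complete_adj_irrefl.

End CompleteGraph.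

(* [cycle_graph k] is the k-cycle only for [3 <= k]; the conjunct [i != j]
   only matters for [k = 1], where [ordS] has a fixed point. *)
Section CycleGraph.
Variable k : nat.

Definition cycle_adj : rel 'I_k := fun i j =>
  (i != j) && ((j == ordS i) || (i == ordS j)).

Lemma cycle_adj_sym : symmetric cycle_adj.
Proof. by move=> i j; rewrite /cycle_adj eq_sym orbC. Qed.

Lemma cycle_adj_irrefl : irreflexive cycle_adj.
Proof. by move=> i; rewrite /cycle_adj eqxx. Qed.

Definition cycle_graph : sgraph := SGraph cycle_adj_sym cycle_adj_irrefl.

End CycleGraph.

(* Main.v *)
Require Import Defs.
From mathcomp Require Import all_boot.
From mathcomp Require Import zify.

Set Implicit Arguments.
Unset Strict Implicit.
Unset Printing Implicit Defensive.

(** Let [v] be a Hamiltonian cycle of [G], with [n] vertices.  Running along [v]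
    in one copy of [G] and back in the other gives a Hamiltonian cycle of the prism
    that folds onto itself: its two halves are joined only by the rungs of a ladder.
    If the prism is Hamiltonian-transitive, every Hamiltonian cycle of it folds in
    this way.  Applied to cycles made of one Hamiltonian path of [G] in each copy,
    with common endpoints, this says that every Hamiltonian path of [G] closes up,
    so that a chord [v_0 v_d] yields the chord [v_1 v_(d+1)]; the two paths
    [v_0 v_1 .. v_(n-1)] and [v_0 v_d v_(d-1) .. v_1 v_(d+1) .. v_(n-1)] then
    contradict folding when [n <= 2d].  Hence [G] is a cycle.  For even [n >= 6] the
    cycle using all the rungs does not fold.

    Conversely, a Hamiltonian cycle of the prism over a cycle that misses a rung
    misses the same edge in both copies and is determined by that edge, hence is
    unique up to rotation; one that uses all the rungs alternates, so the base is
    even, and over a 4-cycle a symmetry of the cube brings it back to the first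
    kind. *)

(** * Vertex sequences of Hamiltonian cycles *)

Lemma cycle_nth (T : Type) (e : rel T) (x0 : T) (s : seq T) :
  (forall i, i < size s -> e (nth x0 s i) (nth x0 s (i.+1 %% size s))) -> cycle e s.
Proof.
case: s => //= x p h; apply/(pathP x0) => i; rewrite size_rcons => ilt.
have := h i ilt; rewrite nth_rcons -rcons_cons nth_rcons /= ilt.
case: ltnP => ip; first by rewrite modn_small.
have -> : i = size p by lia.
by rewrite modnn eqxx.
Qed.

Lemma next_nth_mod (T : eqType) (x0 : T) (s : seq T) (i : nat) :
  uniq s -> i < size s -> next s (nth x0 s i) = nth x0 s (i.+1 %% size s).
Proof.
move=> us ilt; rewrite next_nth mem_nth // index_uniq //.
case: s us ilt => [//|y s] us; rewrite /= ltnS leq_eqVlt => /orP[/eqP ->|ilt].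
  by rewrite modnn nth_default.
by rewrite modn_small //=; apply: set_nth_default.
Qed.

Lemma set2_eq (T : finType) (x y z t : T) :
  ([set x; y] == [set z; t]) = (x == z) && (y == t) || (x == t) && (y == z).
Proof.
apply/eqP/idP => [e|/orP[]/andP[/eqP-> /eqP->] //]; last by rewrite setUC.
have := set21 x y; have := set22 x y; rewrite e !inE.
have := set21 z t; have := set22 z t; rewrite -e !inE !(eq_sym z) !(eq_sym t).
by do 4!case: (_ == _).
Qed.

Section HamiltonianSequences.
Variable G : sgraph.
Implicit Types (s t : seq G) (x y : G).

Definition ham_seq s :=
  [/\ ucycle (@adj G) s, 3 <= size s & forall x, x \in s].

Lemma mem_cycle_edges s x y : (forall z, z \in s) ->
  ([set x; y] \in cycle_edges s) = (y == next s x) || (x == next s y).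
Proof.
move=> sT; apply/imsetP/orP => [[z _ /eqP]|[]/eqP ->].
- by rewrite set2_eq => /orP[]/andP[/eqP-> /eqP->]; rewrite eqxx; [left|right].
- by exists x.
- by exists y; rewrite // setUC.
Qed.

Lemma ham_seq_size s : ham_seq s -> size s = #|G|.
Proof.
by case=> /andP[_ us] _ sT; rewrite -(card_uniqP us); apply: eq_card => x; rewrite sT.
Qed.

Lemma ham_seq_cycle s : ham_seq s -> hamiltonian_cycle (cycle_edges s).
Proof. by case=> ? ? ?; exists s. Qed.

Lemma ham_seq_rot k s : ham_seq s -> ham_seq (rot k s).
Proof.
case=> us s3 sT; split; last by move=> x; rewrite mem_rot.
  by rewrite /ucycle rot_cycle rot_uniq.
by rewrite size_rot.
Qed.

Lemma ham_seq_rev s : ham_seq s -> ham_seq (rev s).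
Proof.
case=> /andP[cs us] s3 sT; split; last by move=> x; rewrite mem_rev.
  rewrite /ucycle rev_uniq us andbT rev_cycle.
  by rewrite (eq_cycle (e' := @adj G)) // => x y; rewrite adj_sym.
by rewrite size_rev.
Qed.

Lemma cycle_edges_rot k s : uniq s -> cycle_edges (rot k s) = cycle_edges s.
Proof.
move=> us; rewrite /cycle_edges; apply/setP => e.
by apply/imsetP/imsetP => -[x]; rewrite ?mem_rot => xs ->; exists x;
  rewrite ?next_rot ?mem_rot.
Qed.

Lemma cycle_edges_rev s : uniq s -> cycle_edges (rev s) = cycle_edges s.
Proof.
move=> us; rewrite /cycle_edges; apply/setP => e.
apply/imsetP/imsetP => -[x]; rewrite ?mem_rev => xs ->.
  by exists (prev s x); rewrite ?mem_prev // next_prev // next_rev // setUC.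
exists (next s x); first by rewrite mem_rev mem_next.
by rewrite next_rev // prev_next // setUC.
Qed.

(** Two consecutive entries determine the next one: of the two neighbours of a vertex on the cycle,
    one has just been visited. The induction therefore carries a pair of consecutive positions. *)
Lemma cycle_edges_inj_prefix s t x y s' t' :
    s = x :: y :: s' -> t = x :: y :: t' -> ham_seq s -> ham_seq t ->
  cycle_edges s = cycle_edges t -> s = t.
Proof.
move=> es et hs ht est.
have szt : size t = size s by rewrite !ham_seq_size.
have [/andP[_ us] _ sT] := hs; have [/andP[_ ut] _ tT] := ht.
have ind i : i.+1 < size s ->
    nth x s i = nth x t i /\ nth x s i.+1 = nth x t i.+1.
  elim: i => [|i IH] ilt; first by rewrite es et.
  have [e1 e2] := IH (ltnW ilt); split=> //.
  have := mem_cycle_edges (nth x s i.+1) (nth x s i.+2) tT.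
  rewrite -est mem_cycle_edges // next_nth_mod ?(ltnW ilt) // modn_small // eqxx /=.
  move/esym/orP=> [/eqP ->|/eqP].
    by rewrite e2 next_nth_mod ?szt ?(ltnW ilt) // modn_small.
  have -> : nth x s i.+1 = next t (nth x s i).
    by rewrite e1 e2 next_nth_mod ?szt ?modn_small //; lia.
  (* The other neighbour on [t] is the vertex at position [i], which [s] cannot visit again at
     [i.+2]. *)
  move/(can_inj (prev_next ut)) => e.
  by have := nth_uniq x ilt (ltnW (ltnW ilt)) us; rewrite e eqxx gtn_eqF.
apply: (@eq_from_nth _ x s t (esym szt)) => i ilt.
case: i ilt => [|i] ilt; first by rewrite es et.
by case: (ind i ilt).
Qed.

(** Rotate [t] to start where [s] does. The first edge of [s] is then the first or the last edge of
    [t]; reversal exchanges these cases, and equal prefixes force equality. *)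
Lemma cycle_edges_rot_rev s t : ham_seq s -> ham_seq t ->
  cycle_edges s = cycle_edges t ->
  exists k, s = rot k t \/ s = rot k (rev t).
Proof.
move=> hs ht est.
have [/andP[_ us] s3 sT] := hs; have [/andP[_ ut] t3 tT] := ht.
case es: s s3 us => [|x [|y s']] //= _ us; rewrite -es.
have exy : next s x = y by rewrite es /= eqxx.
have key r : ham_seq r -> cycle_edges s = cycle_edges r -> y = next r x ->
    exists k, s = rot k r.
  move=> hr er ey; have [/andP[_ ur] r3 rT] := hr.
  have [k r' e] := rot_to (rT x); exists k.
  have := size_rot k r; rewrite e; case: r' e => [|z r'] e szr.
    by move: r3; rewrite -szr.
  apply: (cycle_edges_inj_prefix (x := x) (y := y) (s' := s') (t' := r')) => //.
  - have ez : next (rot k r) x = z by rewrite e /= eqxx.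
    by rewrite ey -ez next_rot.
  - by rewrite -e; exact: ham_seq_rot.
  - by rewrite -e cycle_edges_rot.
have := mem_cycle_edges x y tT.
rewrite -est mem_cycle_edges // exy eqxx /= => /esym/orP[]/eqP exy'.
  by have [k ek] := key t ht est exy'; exists k; left.
have [||k ek] := key (rev t) (ham_seq_rev ht).
- by rewrite cycle_edges_rev.
- by rewrite next_rev // exy' prev_next.
by exists k; right.
Qed.
End HamiltonianSequences.

(** * The folding property of a Hamiltonian-transitive prism *)

Lemma modn_lt2 (m d : nat) : m < d.*2 -> m %% d = if m < d then m else m - d.
Proof.
move=> hm; case: ltnP => h; first by rewrite modn_small.
by rewrite -{1}(subnK h) modnDr modn_small //; lia.
Qed.

Lemma nth_rot_mod (T : Type) (x0 : T) (s : seq T) (k i : nat) :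
  k <= size s -> i < size s -> nth x0 (rot k s) i = nth x0 s ((k + i) %% size s).
Proof.
move=> ks ilt; rewrite /rot nth_cat size_drop nth_drop.
case: ltnP => h; first by rewrite modn_small //; lia.
rewrite nth_take; last by lia.
rewrite -(modnDr _ (size s)); congr nth.
have -> : k + i = i - (size s - k) + size s by lia.
by rewrite !modnDr modn_small //; lia.
Qed.

Section Transport.
Variables G H : sgraph.

Lemma iso_inj (f : G -> H) : is_isomorphism f -> injective f.
Proof. by case=> /bij_inj. Qed.

Lemma edge_image_cycle_edges (f : G -> H) (s : seq G) : injective f -> uniq s ->
  edge_image f (cycle_edges s) = cycle_edges (map f s).
Proof.
move=> fI us; apply/setP => e; apply/imsetP/imsetP.
  case=> _ /imsetP[x xs ->] ->; exists (f x); first exact: map_f.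
  by rewrite (next_map fI us) imsetU !imset_set1.
case=> _ /mapP[x xs ->] ->; exists [set x; next s x]; first by apply/imsetP; exists x.
by rewrite (next_map fI us) imsetU !imset_set1.
Qed.

Lemma ham_seq_map (f : G -> H) (s : seq G) :
  is_isomorphism f -> ham_seq s -> ham_seq (map f s).
Proof.
move=> fiso [/andP[cs us] s3 sT]; have [[g fK gK] fA] := fiso.
split; last by move=> y; rewrite -(gK y); apply: map_f.
  rewrite /ucycle (map_inj_uniq (iso_inj fiso)) us andbT cycle_map.
  by rewrite (eq_cycle (e' := @adj G)).
by rewrite size_map.
Qed.

End Transport.

(** Passes from edge sets to vertex orders, where positions along the cycle can be computed. *)
Lemma ham_transitive_seq (G : sgraph) (s t : seq G) : hamiltonian_transitive G ->
  ham_seq s -> ham_seq t ->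
  exists f : G -> G, is_automorphism f /\
    exists k, map f s = rot k t \/ map f s = rot k (rev t).
Proof.
move=> [_ tr] hs ht; have [f [fA e]] := tr _ _ (ham_seq_cycle hs) (ham_seq_cycle ht).
exists f; split=> //; apply: cycle_edges_rot_rev => //; first exact: ham_seq_map.
by rewrite -e edge_image_cycle_edges //; [exact: iso_inj|case: hs => /andP[]].
Qed.

(* The edges between the two halves of the cyclic order [w] are exactly those of
   the perfect matching [i |-> n.*2.-1 - i]. *)
Definition ladder (H : sgraph) (n : nat) (w : nat -> H) : Prop :=
  [/\ forall i j, i < n -> n <= j -> j < n.*2 -> adj (w i) (w j) = (i + j == n.*2.-1),
      adj (w 0) (w n.-1) & adj (w n) (w n.*2.-1)].

(** The map [i |-> n.*2.-1 - i] exchanges the two halves and preserves the matching, since matched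
    positions sum to [n.*2.-1]. *)
Lemma ladder_rev (H : sgraph) (n : nat) (w : nat -> H) : 0 < n ->
  ladder n w -> ladder n (fun i => w (n.*2.-1 - i)).
Proof.
move=> n0 [l e1 e2]; split.
- move=> i j ilt jge jlt; rewrite adj_sym l; [|lia..].
  by apply/eqP/eqP; lia.
- by rewrite subn0 (_ : n.*2.-1 - n.-1 = n) 1?adj_sym //; lia.
- by rewrite subnn (_ : n.*2.-1 - n = n.-1) 1?adj_sym //; lia.
Qed.

Lemma eq_ladder (H : sgraph) (n : nat) (w w' : nat -> H) : 0 < n ->
  (forall i, i < n.*2 -> w i = w' i) -> ladder n w -> ladder n w'.
Proof.
move=> n0 e [l e1 e2]; split.
- by move=> i j ilt jge jlt; rewrite -!e ?l //; lia.
- by rewrite -!e //; lia.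
- by rewrite -!e //; lia.
Qed.

(** A ladder is a pattern of adjacencies, so an automorphism carries it from [u] to [w] up to
    rotation and reversal. Reversal is absorbed by [ladder_rev], leaving only an offset [c]. *)
Lemma ladder_transport (H : sgraph) (n : nat) (u w : seq H) (x0 : H) : 0 < n ->
  hamiltonian_transitive H -> ham_seq u -> ham_seq w -> size w = n.*2 ->
  ladder n (nth x0 u) ->
  exists2 c, c < n.*2 & ladder n (fun i => nth x0 w ((c + i) %% n.*2)).
Proof.
move=> n0 tr hu hw sw l.
have su : size u = n.*2 by rewrite -sw !ham_seq_size.
have [f [[_ fA] [k ek]]] := ham_transitive_seq tr hu hw.
have {}l : ladder n (nth (f x0) (map f u)).
  case: l => l e1 e2; split.
  - by move=> i j ilt jge jlt; rewrite !(nth_map x0) ?fA ?l ?su //; lia.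
  - by rewrite !(nth_map x0) ?fA ?su //; lia.
  - by rewrite !(nth_map x0) ?fA ?su //; lia.
have red (r : seq H) : size r = n.*2 -> exists2 c, c < n.*2 & rot k r = rot c r.
  move=> sr; case: (ltnP k n.*2) => hk; first by exists k.
  by exists 0; [lia|rewrite rot_oversize ?sr // rot0].
case: ek l => ->.
  have [c cn ->] := red w sw => l; exists c => //.
  apply: eq_ladder l => // i ilt.
  by rewrite nth_rot_mod ?sw ?(ltnW cn) //; apply: set_nth_default; rewrite sw ltn_pmod //; lia.
have [|c cn ->] := red (rev w); first by rewrite size_rev.
(* Reading a rotation by [c] of [rev w] backwards gives the rotation of [w] by [n.*2 - c]; the
   modulus covers [c = 0]. *)
move/(ladder_rev n0) => l; exists ((n.*2 - c) %% n.*2); first by rewrite ltn_pmod; lia.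
apply: eq_ladder l => // i ilt.
rewrite nth_rot_mod ?size_rev ?sw; [|lia..].
rewrite nth_rev ?sw ?ltn_pmod; [|lia..].
rewrite (set_nth_default x0) ?sw; last by lia.
congr nth; rewrite modnDml !modn_lt2; [|lia..].
by do 2!case: ltnP => ?; lia.
Qed.

Notation prism G := (cart_prod G (complete_graph 2)).

(** * Pairs of paths in the two copies, and ladders on the resulting cycle *)

Section Prism.
Variable G : sgraph.

Lemma prism_adj (x y : G) (a b : 'I_2) :
  adj ((x, a) : prism G) (y, b) = if a == b then adj x y else x == y.
Proof.
by rewrite /adj /cart_prod /cart_adj /= /complete_adj; case: (a == b); rewrite ?andbF ?andbT ?orbF.
Qed.

Lemma two_levels (a b c : 'I_2) : a != b -> (c == b) = (c != a).
Proof. by case: a b c => [[|[|]]] // ? [[|[|]]] // ? [[|[|]]]. Qed.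

(** The indexing agrees with [ladder]: where [P] and [Q] coincide, positions with sum [n.*2.-1] are
    the ends of a rung. *)
Definition fold (n : nat) (a b : 'I_2) (P Q : nat -> G) (i : nat) : prism G :=
  if i < n then (P i, a) else (Q (n.*2.-1 - i), b).

Section FoldLadder.
Variables (n : nat) (a b : 'I_2) (P Q : nat -> G) (c : nat).
Hypothesis neq_ab : a != b.
Hypothesis injQ : forall i j, i < n -> j < n -> (Q i == Q j) = (i == j).
Hypothesis head_eq : P 0 = Q 0.
Hypothesis last_eq : P n.-1 = Q n.-1.
Hypothesis lad : ladder n (fun i => fold n a b P Q ((c + i) %% n.*2)).

(** The ladder starts in the interior of the [P] part. Comparing its matching with the copies in
    which the matched positions lie forces the offset to be exactly half of [n]. *)
Lemma fold_ladder_middle : 0 < c -> c < n ->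
  [/\ n = c.*2, adj (P 0) (P n.-1) &
      forall i j, i < n -> j < n -> P i = Q j -> (i < c) = (j < c)].
Proof.
move=> c0 cn; have neq_ba : b != a by rewrite eq_sym.
have [l _ _] := lad.
(* Matched positions sum to [n.*2.-1 + c.*2], or to [c.*2.-1] when the second one has wrapped
   around; [lA] and [lB] are these two cases. *)
have lA u v : c <= u -> u < c + n -> c + n <= v -> v < n.*2 ->
    adj (fold n a b P Q u) (fold n a b P Q v) = (u + v == n.*2.-1 + c.*2).
  move=> cu un nv vn; have := l (u - c) (v - c).
  rewrite !subnKC; [|lia..]; rewrite !modn_small; [|lia..].
  by move=> ->; [apply/eqP/eqP|..]; lia.
have lB u v : c <= u -> u < c + n -> v < c ->
    adj (fold n a b P Q u) (fold n a b P Q v) = (u + v == c.*2.-1).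
  move=> cu un vc; have := l (u - c) (v + n.*2 - c).
  rewrite !subnKC; [|lia..]; rewrite modnDr !modn_small; [|lia..].
  by move=> ->; [apply/eqP/eqP|..]; lia.
(* If [c.*2 < n], position [n.-1] is matched with [n + c.*2] in the other copy. Both then lie over
   one vertex, so [Q] takes the same value at [n.-1] and at [n.-1 - c.*2]. *)
have c2n : n <= c.*2.
  rewrite leqNgt; apply/negP => h.
  have: adj (fold n a b P Q n.-1) (fold n a b P Q (n + c.*2)) by rewrite lA; lia.
  rewrite /fold (_ : n.-1 < n = true) 1?(_ : n + c.*2 < n = false); [|lia..].
  by rewrite prism_adj (negPf neq_ab) last_eq injQ; lia.
(* Likewise at the other end: positions [c.*2.-1] and [0] would lie over the same vertex, giving a
   second occurrence of [Q 0]. *)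
have n2c : c.*2 <= n.
  rewrite leqNgt; apply/negP => h.
  have: adj (fold n a b P Q c.*2.-1) (fold n a b P Q 0) by rewrite lB; lia.
  rewrite /fold (_ : 0 < n = true) 1?(_ : c.*2.-1 < n = false); [|lia..].
  by rewrite prism_adj (negPf neq_ba) head_eq injQ; lia.
have en : n = c.*2 by lia.
split=> //.
  have: adj (fold n a b P Q n.-1) (fold n a b P Q 0) by rewrite lB; lia.
  rewrite /fold (_ : 0 < n = true) 1?(_ : n.-1 < n = true); [|lia..].
  by rewrite prism_adj eqxx adj_sym.
move=> i j ilt jlt eij.
(* A common vertex [P i = Q j] gives a rung between these positions. With [i] and [j] on different
   sides of [c], the rung would cross between the halves of the ladder with the wrong sum. *)
have rung : adj (fold n a b P Q i) (fold n a b P Q (n.*2.-1 - j)).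
  rewrite /fold ilt (_ : n.*2.-1 - j < n = false); last by lia.
  by rewrite prism_adj (negPf neq_ab) subKn ?eij //; lia.
case: (ltnP i c) => ic; case: (ltnP j c) => jc //.
  by move: rung; rewrite adj_sym lB; lia.
by move: rung; rewrite lA; lia.
Qed.

End FoldLadder.

(** Offsets [0] and [n] match the copies with each other and force [P = Q]; any other offset falls
    under [fold_ladder_middle], directly or after exchanging the copies. *)
Lemma fold_ladder n (a b : 'I_2) (P Q : nat -> G) c : a != b ->
    (forall i j, i < n -> j < n -> (P i == P j) = (i == j)) ->
    (forall i j, i < n -> j < n -> (Q i == Q j) = (i == j)) ->
    P 0 = Q 0 -> P n.-1 = Q n.-1 -> 0 < n -> c < n.*2 ->
    ladder n (fun i => fold n a b P Q ((c + i) %% n.*2)) ->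
  adj (P 0) (P n.-1) /\
  ((forall i, i < n -> P i = Q i) \/
   exists2 h, n = h.*2 &
     forall i j, i < n -> j < n -> P i = Q j -> (i < h) = (j < h)).
Proof.
move=> ab iP iQ e0 e1 n0 cn l; have ba : b != a by rewrite eq_sym.
case: (ltngtP c n) => [cn'|cn'|ec]; last first.
(* Starting [n] positions later, the same cycle is a fold that begins in copy [b], with both
   sequences reversed. *)
- have {}l : ladder n (fun i => fold n b a (fun i => Q (n.-1 - i)) (fun i => P (n.-1 - i)) i).
    apply: eq_ladder l => // i ilt; rewrite ec modn_lt2; last by lia.
    rewrite /fold; case: (ltnP (n + i)) => h; case: (ltnP i) => h'; try lia.
      by case: ltnP => h2; [lia|congr (Q _, b); lia].
    by case: ltnP => h2; [congr (P _, a); lia|lia].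
  case: l => l _ l2; split.
    move: l2; rewrite /fold ltnn (_ : n.*2.-1 < n = false); last by lia.
    rewrite prism_adj eqxx; congr (adj (P _) (P _)); lia.
  left=> i ilt; have := l (n.-1 - i) (n + i).
  rewrite /fold (_ : n.-1 - i < n) 1?(_ : n + i < n = false); [|lia..].
  rewrite prism_adj (negPf ba) (_ : n.-1 - (n.-1 - i) = i); last by lia.
  rewrite (_ : n.-1 - (n.*2.-1 - (n + i)) = i); last by lia.
  move=> h; apply/eqP; rewrite eq_sym h; lia.
- have {}l : ladder n (fun i => fold n b a (fun i => Q (n.-1 - i)) (fun i => P (n.-1 - i))
                (((c - n) + i) %% n.*2)).
    apply: eq_ladder l => // i ilt; rewrite !modn_lt2; [|lia..].
    rewrite /fold; case: (ltnP (c + i)) => h; case: (ltnP (c - n + i)) => h'; try lia.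
    + by case: (ltnP (c + i)) => h2; case: ltnP => h3; try lia;
        first [congr (Q _, b) | congr (P _, a)]; lia.
    + by case: (ltnP (c + i - n.*2)) => h2; case: ltnP => h3; try lia;
        first [congr (Q _, b) | congr (P _, a)]; lia.
    + by case: (ltnP (c + i - n.*2)) => h2; case: ltnP => h3; try lia;
        first [congr (Q _, b) | congr (P _, a)]; lia.
  have [|||||h1 h2 h3] := fold_ladder_middle ba _ _ _ l.
  + by move=> i j ilt jlt; rewrite iP; lia.
  + by rewrite subn0.
  + by rewrite subnn.
  + by lia.
  + by lia.
  move: h2; rewrite subn0 subnn -e0 -e1 => h2; split; first by rewrite adj_sym.
  right; exists (c - n) => // i j ilt jlt eij.
  have := h3 (n.-1 - j) (n.-1 - i); rewrite !subKn; [|lia..].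
  by rewrite eij => h; have := h _ _ erefl; lia.
- case: (posnP c) => [c0|c0].
  + have {}l : ladder n (fun i => fold n a b P Q i).
      by apply: eq_ladder l => // i ilt; rewrite c0 modn_small.
    case: l => l l2 _; split.
      by move: l2; rewrite /fold n0 prednK // leqnn prism_adj eqxx.
    left=> i ilt; have := l i (n.*2.-1 - i).
    rewrite /fold ilt (_ : n.*2.-1 - i < n = false); last by lia.
    rewrite prism_adj (negPf ab) (_ : n.*2.-1 - (n.*2.-1 - i) = i); last by lia.
    by move=> h; apply/eqP; rewrite h; lia.
  + have [h1 h2 h3] := fold_ladder_middle ab iQ e0 e1 l c0 cn'.
    by split=> //; right; exists c.
Qed.
End Prism.

(** * Absence of chords *)

Section Chords.
Variable G : sgraph.
Implicit Types (p q s v : seq G) (x y : G).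

Definition level (a : 'I_2) (x : G) : prism G := (x, a).

Lemma adj_level (a b : 'I_2) x y :
  adj (level a x) (level b y) = if a == b then adj x y else x == y.
Proof. exact: prism_adj. Qed.

Definition fold_seq (a b : 'I_2) p q : seq (prism G) :=
  map (level a) p ++ rev (map (level b) q).

Lemma size_fold_seq a b p q : size (fold_seq a b p q) = size p + size q.
Proof. by rewrite size_cat size_rev !size_map. Qed.

Lemma nth_fold_seq (x0 : prism G) a b p q i : size q = size p -> i < (size p).*2 ->
  nth x0 (fold_seq a b p q) i = fold (size p) a b (nth x0.1 p) (nth x0.1 q) i.
Proof.
move=> sqp ilt; rewrite nth_cat size_map /fold; case: ltnP => h.
  by rewrite (nth_map x0.1).
rewrite nth_rev size_map; last by lia.
rewrite (nth_map x0.1); last by lia.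
by congr (nth _ _ _, _); lia.
Qed.

Definition ham_path s :=
  [/\ sorted (@adj G) s, uniq s & forall x, x \in s].

Lemma ham_path_size s : ham_path s -> size s = #|G|.
Proof.
by case=> _ us sT; rewrite -(card_uniqP us); apply: eq_card => x; rewrite sT.
Qed.

Lemma ham_seq_path s : ham_seq s -> ham_path s.
Proof.
case=> /andP[cs us] _ sT; split=> //.
by case: s cs {us sT} => //= x s; rewrite rcons_path => /andP[].
Qed.

(** The common endpoints of [p] and [q] supply the two rungs that close the cycle. *)
Lemma ham_fold_seq a b p q x0 : a != b -> ham_path p -> ham_path q -> 1 < size p ->
  head x0 p = head x0 q -> last x0 p = last x0 q -> ham_seq (fold_seq a b p q).
Proof.
move=> ab hp hq p1; have ba : b != a by rewrite eq_sym.
have szq : size q = size p by rewrite !ham_path_size.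
have [sp up pT] := hp; have [sq uq qT] := hq.
have levelI c : injective (level c) by move=> y z [].
case: p p1 szq sp up pT {hp} => [//|x p] p1; case: q sq uq qT {hq} => [//|y q].
move=> sq uq qT szq sp up pT /= exy; rewrite -{}exy in sq uq qT * => el.
split.
- apply/andP; split; last first.
    rewrite cat_uniq rev_uniq !(map_inj_uniq (levelI _)) up uq !andbT.
    apply/hasPn => z; rewrite mem_rev => /mapP[z1 _ ->].
    by apply/negP => /mapP[z2 _ [_ e]]; rewrite e eqxx in ba.
  rewrite /fold_seq /= rcons_cat cat_path last_map path_map.
  rewrite (eq_path (e' := @adj G)); last first.
    by move=> y1 y2; have := adj_level a a y1 y2; rewrite eqxx.
  rewrite [path _ x p]sp /= rev_cons.
  have -> : rcons (rcons (rev (map (level b) q)) (level b x)) (level a x)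
     = rcons (rev (level b x :: map (level b) q)) (level a x) by rewrite rev_cons.
  rewrite (lastI (level b x)) rev_rcons /= rcons_path rev_path last_map -el.
  have cart c d y z : cart_adj (H := complete_graph 2) (level c y) (level d z) =
      if c == d then adj y z else y == z := adj_level c d y z.
  rewrite cart (negPf ab) eqxx /= path_map.
  rewrite (eq_path (e' := @adj G)); last first.
    by move=> y1 y2; rewrite /= cart eqxx adj_sym.
  move: sq => /= -> /=; have: 0 < size q by move: szq p1 => /=; lia.
  by case: (q) => //= y2 q' _; rewrite rev_cons last_rcons cart (negPf ba) eqxx.
- by rewrite size_fold_seq /=; move: p1 => /=; lia.
- move=> [z c]; rewrite mem_cat mem_rev; apply/orP.
  have := two_levels c ab; case: (c =P a) => [-> _|_ /= /eqP ->].
    by left; exact: (map_f (level a) (pT z)).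
  by right; exact: (map_f (level b) (qT z)).
Qed.

Lemma nth_uniq_lt (x0 : G) p i j : uniq p -> i < size p -> j < size p ->
  (nth x0 p i == nth x0 p j) = (i == j).
Proof. by move=> up ip jp; rewrite nth_uniq. Qed.

Section Transitive.
Variable s : seq G.
Hypothesis hs : ham_seq s.
Hypothesis tr : hamiltonian_transitive (prism G).

Let neq01 : (ord0 : 'I_2) != ord_max. Proof. by []. Qed.

(** With the same sequence in both copies, the edges between the copies are exactly the rungs, and
    the closing edge of [s] joins the ends of each half. *)
Lemma ladder_ham_fold (x0 : prism G) :
  ladder (size s) (nth x0 (fold_seq ord0 ord_max s s)).
Proof.
have [/andP[cs us] s3 sT] := hs.
have s0 : 0 < size s by lia.
apply: (eq_ladder (w := fold (size s) ord0 ord_max (nth x0.1 s) (nth x0.1 s))) => //.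
  by move=> i ilt; rewrite nth_fold_seq.
have close : adj (nth x0.1 s 0) (nth x0.1 s (size s).-1).
  rewrite nth_last nth0; case: (s) cs s3 => //= y s'.
  by rewrite rcons_path => /andP[_]; rewrite adj_sym.
split.
- move=> i j ilt jge jlt; rewrite /fold ilt ltnNge jge prism_adj.
  by rewrite (negPf neq01) nth_uniq_lt //; [apply/eqP/eqP|]; lia.
- by rewrite /fold s0 prednK // leqnn prism_adj eqxx.
- rewrite /fold ltnn (_ : (size s).*2.-1 < size s = false); last by lia.
  rewrite prism_adj eqxx adj_sym.
  rewrite (_ : (size s).*2.-1 - (size s).*2.-1 = 0); last by lia.
  by rewrite (_ : (size s).*2.-1 - size s = (size s).-1) //; lia.
Qed.

(** Transitivity carries the standard fold of [s] to [w]. *)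
Lemma ladder_of_ham_seq (w : seq (prism G)) (x0 : prism G) : ham_seq w ->
  exists2 c, c < (size s).*2 & ladder (size s) (fun i => nth x0 w ((c + i) %% (size s).*2)).
Proof.
have [_ s3 _] := hs => hw.
have hf : ham_seq (fold_seq ord0 ord_max s s).
  have hp := ham_seq_path hs; apply: (ham_fold_seq (x0 := x0.1)) => //; lia.
apply: (ladder_transport _ tr hf) => //; first by lia.
  by rewrite (ham_seq_size hw) -(ham_seq_size hf) size_fold_seq addnn.
exact: ladder_ham_fold.
Qed.

Lemma ham_path_pair x0 p q : ham_path p -> ham_path q ->
    head x0 p = head x0 q -> last x0 p = last x0 q ->
  adj (head x0 p) (last x0 p) /\
  (p = q \/ exists2 h, #|G| = h.*2 &
     forall i j, i < #|G| -> j < #|G| -> nth x0 p i = nth x0 q j -> (i < h) = (j < h)).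
Proof.
move=> hp hq e0 e1; have [_ s3 _] := hs.
have [_ up pT] := hp; have [_ uq qT] := hq.
have szs := ham_seq_size hs; have szp := ham_path_size hp; have szq := ham_path_size hq.
have hw : ham_seq (fold_seq ord0 ord_max p q).
  by apply: (ham_fold_seq (x0 := x0)) => //; lia.
have [c cs l] := ladder_of_ham_seq (x0, ord0) hw.
rewrite szs in cs l s3.
rewrite -!nth0 -!nth_last szp szq in e0 e1 *.
have [|||||||cl alt] := @fold_ladder G #|G| ord0 ord_max (nth x0 p) (nth x0 q) c neq01.
- by move=> i j ilt jlt; rewrite nth_uniq_lt // szp.
- by move=> i j ilt jlt; rewrite nth_uniq_lt // szq.
- by [].
- by [].
- by lia.
- by [].
- apply: eq_ladder l => [|i ilt]; first by lia.
  by rewrite nth_fold_seq ?szp ?szq // ltn_pmod //; lia.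
split=> //; case: alt => [e|]; [left|by right].
by apply: (@eq_from_nth _ x0) => [|i]; rewrite szp ?szq //; apply: e.
Qed.

Lemma ham_path_closed x0 p : ham_path p -> adj (head x0 p) (last x0 p).
Proof. by move=> hp; have [] := @ham_path_pair x0 p p hp hp erefl erefl. Qed.

Lemma perm_ham_path p q : ham_path p -> perm_eq p q -> sorted (@adj G) q -> ham_path q.
Proof.
move=> [_ up pT] pq sq; split=> //; first by rewrite -(perm_uniq pq).
by move=> x; rewrite -(perm_mem pq).
Qed.

(** The chord, together with the edge [b c] that it yields, gives a second Hamiltonian path with the
    same endpoints. The two paths share neither their order nor their halves, against
    [ham_path_pair]. *)
Lemma no_long_chord (a b c : G) t u : ham_seq (a :: (b :: t) ++ c :: u) ->
  0 < size t -> size u <= size t -> ~~ adj a (last b t).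
Proof.
move=> hv t0 ut; apply/negP => chord; have hpv := ham_seq_path hv.
have [+ uv vT] := hpv; rewrite /= cat_path /= => /and4P[ab pt tc pu].
(* Go from [b] to the end of [t], along the chord to [a], along the closing edge of the cycle, and
   back to [c]: this Hamiltonian path closes up. *)
have bc : adj b c.
  have hp : ham_path ((b :: t) ++ a :: rev (c :: u)).
    apply: perm_ham_path hpv _ _.
      by rewrite -cat1s perm_catCA perm_cat2l perm_cons perm_sym perm_rev.
    rewrite /= cat_path pt /= adj_sym chord /= (lastI c) rev_rcons /=.
    have [/andP[+ _] _ _] := hv; rewrite /= rcons_path last_cat /= => /andP[_ /andP[_ ua]].
    rewrite adj_sym ua /= rev_path.
    by rewrite (eq_path (e' := @adj G)) // => y1 y2; rewrite adj_sym.
  have := ham_path_closed a hp.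
  by rewrite /= last_cat /= rev_cons last_rcons.
(* Turning the segment [b :: t] around uses the chord and [bc], and keeps both endpoints. *)
have hq : ham_path (a :: rev (b :: t) ++ c :: u).
  apply: perm_ham_path hpv _ _; first by rewrite perm_cons perm_cat2r perm_sym perm_rev.
  rewrite /= cat_path /= (lastI b) rev_rcons /= chord /=.
  rewrite rev_path (eq_path (e' := @adj G)) ?pt /=; last by move=> y1 y2; rewrite adj_sym.
  by rewrite pu andbT; case: (t) t0 => //= y t' _; rewrite rev_cons last_rcons.
have szv := ham_path_size hpv.
have [|_ [e|[h nh e]]] := ham_path_pair (x0 := a) hpv hq erefl.
- by rewrite /= !last_cat.
- have lt : last b t \in t by case: (t) t0 => //= y t' _; apply: mem_last.
  have eb : b = last b t by move: e; rewrite (lastI b t) rev_rcons /= -lastI => -[].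
  by move: uv => /= /and3P[_ +]; rewrite mem_cat {1}eb lt.
have szG : #|G| = (size t + size u).+3 by rewrite -szv /= size_cat /=; lia.
(* The vertex [last b t] has position [(size t).+1] on one path and [1] on the other. From
   [size u <= size t] follows [h <= (size t).+1], while [1 < h]. *)
have := e (size t).+1 1; rewrite szG /= -cat_cons nth_cat /= ltnSn nth_last /=.
rewrite (lastI b t) rev_rcons /=.
by move=> /(_ _ _ erefl); lia.
Qed.
Lemma no_long_chord_nth x0 v d : ham_seq v -> 1 < d -> d.+1 < size v ->
  size v <= d.*2 -> ~~ adj (nth x0 v 0) (nth x0 v d).
Proof.
move=> hv d1 dn nd; case: v hv dn nd => [//|a v] hv dn nd.
have := cat_take_drop d v; have := size_takel (s := v) (n0 := d).
have := size_drop d v; case: (take d v) => [|b t] sdr st ev.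
  by have : 0 = d by [apply: st; move: dn => /=; lia]; lia.
case: (drop d v) sdr ev => [|c u] /= sdr ev; first by move: dn => /=; lia.
have {}st : (size t).+1 = d by apply: st; move: dn => /=; lia.
rewrite -ev in hv *.
have -> : nth x0 (a :: b :: t ++ c :: u) d = last b t.
  by rewrite -st [LHS]/= -cat_cons nth_cat /= ltnSn -[last b t]/(last x0 (b :: t)) -nth_last.
by apply: no_long_chord hv _ _; move: nd dn; rewrite -ev /= size_cat /=; lia.
Qed.

Lemma ham_seq_adj_next x0 v i : ham_seq v -> i < size v ->
  adj (nth x0 v i) (nth x0 v (i.+1 %% size v)).
Proof.
move=> [/andP[cv uv] _ _] iv; rewrite -next_nth_mod //.
by apply: next_cycle cv _; apply: mem_nth.
Qed.

(** Seen from [i] a chord spans [j - i] steps, seen from [j] the complementary number. One of these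
    is at least half the length, and a rotation brings that end to the front. *)
Lemma no_chord x0 v i j : ham_seq v -> i < j -> j < size v ->
  adj (nth x0 v i) (nth x0 v j) = (j == i.+1) || (i == 0) && (j == (size v).-1).
Proof.
move=> hv ij jn; case: eqP => [->|nij] /=.
  by rewrite -(@modn_small i.+1 (size v)) ?ham_seq_adj_next //; lia.
case: andP => [[/eqP-> /eqP->]|nn].
  have -> : nth x0 v 0 = nth x0 v ((size v).-1.+1 %% size v).
    by rewrite prednK ?modnn //; lia.
  by rewrite adj_sym ham_seq_adj_next //; lia.
have rotH k d : k < size v -> 1 < d -> d.+1 < size v -> size v <= d.*2 ->
    ~~ adj (nth x0 v k) (nth x0 v ((k + d) %% size v)).
  move=> kv d1 dv vd.
  have := @no_long_chord_nth x0 (rot k v) d (ham_seq_rot k hv) d1.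
  rewrite size_rot !nth_rot_mod ?addn0 ?(modn_small kv); [|lia..].
  by apply.
apply/negbTE; case: (leqP (size v) (j - i).*2) => h.
  have := rotH i (j - i); rewrite subnKC ?modn_small //; [|lia].
  by apply; lia.
have := rotH j (size v - (j - i)).
have -> : (j + (size v - (j - i))) %% size v = i.
  by rewrite (_ : j + _ = i + size v) ?modnDr ?modn_small; lia.
by rewrite adj_sym; apply; lia.
Qed.

End Transitive.

(** Zigzag order: positions [i.*2] and [i.*2.+1] are the rung over the [i]-th vertex, traversed
    upwards for even [i] and downwards for odd [i]. It closes up in copy [ord0] only for even
    length. *)
Definition comb (x0 : G) v (m : nat) : prism G :=
  level (if odd (m.+1)./2 then ord_max else ord0) (nth x0 v m./2).

Lemma ham_comb x0 v : ham_seq v -> ~~ odd (size v) ->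
  ham_seq (mkseq (comb x0 v) (size v).*2).
Proof.
move=> hv ev; have [/andP[cv uv] v3 vT] := hv.
have combE y c : exists2 m, m < (size v).*2 & comb x0 v m = level c y.
  have /(nthP x0)[i iv <-] := vT y.
  (* Position [i.*2] lies in the copy given by the parity of [i]; the other end of the rung comes
     one later. *)
  exists (i.*2 + (odd i != (c == ord_max))).
    by move: iv; case: (_ != _); set n := size v => iv; lia.
  rewrite /comb; congr level; last by congr nth; lia.
  have -> : odd (i.*2 + (odd i != (c == ord_max))).+1./2 = (c == ord_max).
    by case: (c == ord_max); case: (boolP (odd i)) => oi /=; lia.
  by case: c => [[|[|]]] //= ?; apply: val_inj.
split.
- apply/andP; split.
  + apply: (cycle_nth (x0 := level ord0 x0)) => m; rewrite size_mkseq => mlt.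
    rewrite !nth_mkseq ?ltn_pmod //; last by lia.
    rewrite adj_level; case: (boolP (odd m)) => om.
      rewrite (_ : odd (m.+1 %% _).+1./2 = odd m.+1./2); last first.
        have [->|h] : m.+1 = (size v).*2 \/ m.+1 < (size v).*2 by lia.
          by rewrite modnn doubleK (negPf ev).
        by rewrite modn_small //; lia.
      rewrite eqxx (_ : (m.+1 %% _)./2 = m./2.+1 %% size v); last first.
        have [e|h] : m.+1 = (size v).*2 \/ m.+1 < (size v).*2 by lia.
          by rewrite e modnn (_ : m./2.+1 = size v) ?modnn; lia.
        by rewrite !modn_small; lia.
      by apply: ham_seq_adj_next => //; lia.
    rewrite modn_small; last by lia.
    rewrite (_ : m.+1./2 = m./2) 1?(_ : m.+2./2 = m./2.+1); [|lia..].
    by rewrite /= eqxx; case: (odd _).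
  + apply: (leq_size_uniq (enum_uniq (prism G))).
      move=> [y c] _; have [m mlt e] := combE y c.
      by rewrite -[(y, c)]/(level c y) -e; apply: map_f; rewrite mem_iota.
    by rewrite size_mkseq -cardT card_prod card_ord muln2 -(ham_seq_size hv).
- rewrite size_mkseq; lia.
- move=> [y c]; have [m mlt e] := combE y c.
  by rewrite -[(y, c)]/(level c y) -e; apply: map_f; rewrite mem_iota.
Qed.
End Chords.

(** * The base graph is a cycle, of length at most 4 if even *)

Section Forward.
Variables (G : sgraph) (v : seq G).
Hypothesis hv : ham_seq v.
Hypothesis tr : hamiltonian_transitive (prism G).

(** Positions [size v - 3] and [size v + 2] are matched in a ladder, but five steps apart on the
    comb. They lie over vertices two or three steps apart on [v], which are distinct and, without
    chords, not adjacent once the even length is at least 6. *)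
Lemma ham_seq_even_le4 : ~~ odd (size v) -> size v <= 4.
Proof.
move=> ev; rewrite leqNgt; apply/negP => n5.
have x0 : G by case: (v) n5.
have [/andP[cv uv] v3 vT] := hv.
have [c cn [l _ _]] := ladder_of_ham_seq hv tr (level ord0 x0) (ham_comb x0 hv ev).
have := l (size v - 3) (size v + 2).
set m1 := (c + (size v - 3)) %% _; set m2 := (c + (size v + 2)) %% _.
have m1n : m1 < (size v).*2 by rewrite ltn_pmod; lia.
have m2n : m2 < (size v).*2 by rewrite ltn_pmod; lia.
have m12 : m2 = m1 + 5 \/ m2 + (size v).*2 = m1 + 5.
  have : (m1 + 5) %% (size v).*2 = m2.
    by rewrite modnDml; congr (_ %% _); lia.
  by rewrite modn_lt2; last lia; case: (ltnP (m1 + 5)); lia.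
rewrite !nth_mkseq // => h.
have {h} : adj (comb x0 v m1) (comb x0 v m2) by rewrite h; lia.
rewrite adj_level; set b := _ == _.
have hadj i j : i < j -> j < size v -> adj (nth x0 v i) (nth x0 v j) ->
    j = i.+1 \/ i = 0 /\ j = (size v).-1.
  move=> ij jn; rewrite (no_chord hv tr) //.
  by case/orP=> [/eqP|/andP[/eqP-> /eqP->]]; [left|right].
have : m1./2 <> m2./2 by lia.
have i1 : m1./2 < size v by lia.
have i2 : m2./2 < size v by lia.
move=> ne; case: b; last by rewrite nth_uniq // => /eqP.
case: (ltngtP m1./2 m2./2) => // hlt; first by move/(hadj _ _ hlt i2); lia.
by rewrite adj_sym => /(hadj _ _ hlt i1); lia.
Qed.

Lemma chordless_iso : isomorphic G (cycle_graph (size v)).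
Proof.
have [/andP[cv uv] v3 vT] := hv.
have ilt x : index x v < size v by rewrite index_mem.
exists (fun x => Ordinal (ilt x)); split.
  apply: inj_card_bij => [x y [e]|].
    by rewrite -(nth_index x (vT x)) e nth_index.
  by rewrite card_ord (ham_seq_size hv).
have key x y : index x v < index y v ->
   adj (Ordinal (ilt x) : cycle_graph (size v)) (Ordinal (ilt y)) = adj x y.
  move=> xy; rewrite -[x in RHS](nth_index x (vT x)) -[y in RHS](nth_index x (vT y)).
  rewrite (no_chord hv tr) // /= /cycle_adj -!val_eqE /=.
  rewrite (modn_small (m := (index x v).+1)); last by have := ilt y; lia.
  have [e|h] : (index y v).+1 = size v \/ (index y v).+1 < size v by have := ilt y; lia.
    by rewrite e modnn; lia.
  by rewrite modn_small //; lia.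
move=> x y; case: (ltngtP (index x v) (index y v)) => h; first exact: key.
  by rewrite adj_sym key // adj_sym.
have -> : x = y by rewrite -(nth_index x (vT x)) h nth_index.
by rewrite !adj_irrefl.
Qed.

End Forward.

(** * Hamiltonian cycles of the prism over a cycle *)

Section CycleEdges.
Variable G : sgraph.
Implicit Types (s t : seq G) (x y : G).

Definition on_cycle s x y := [set x; y] \in cycle_edges s.

Lemma on_cycle_sym s x y : on_cycle s x y = on_cycle s y x.
Proof. by rewrite /on_cycle setUC. Qed.

Lemma on_cycleE s x y : ham_seq s -> on_cycle s x y = (y == next s x) || (y == prev s x).
Proof.
case=> /andP[_ us] _ sT; rewrite /on_cycle mem_cycle_edges //; congr (_ || _).
by apply/eqP/eqP => ->; rewrite ?prev_next ?next_prev.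
Qed.

Lemma on_cycle_adj s x y : ham_seq s -> on_cycle s x y -> adj x y.
Proof.
move=> hs; rewrite on_cycleE //; case: hs => /andP[cs _] _ sT /orP[]/eqP->.
  exact: next_cycle.
by rewrite adj_sym; apply: prev_cycle.
Qed.

Lemma next_neq_prev s x : ham_seq s -> next s x != prev s x.
Proof.
move=> [/andP[_ us] s3 sT]; apply/eqP => e.
have : next s (next s x) = x by rewrite e next_prev.
have /(nthP x)[i ilt <-] := sT x.
rewrite !next_nth_mod ?ltn_pmod //; last by lia.
move/eqP; rewrite nth_uniq ?ltn_pmod //; last by lia.
move: (size s) s3 ilt => n n3 ilt; rewrite -addn1 modnDml addn1 modn_lt2; last by lia.
by case: (ltnP i.+2); lia.
Qed.

(** The successor and the predecessor of [x] are two distinct vertices among its three possible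
    neighbours. *)
Lemma cubic_degree s x a b c : ham_seq s -> uniq [:: a; b; c] ->
    (forall y, adj x y -> y \in [:: a; b; c]) ->
  on_cycle s x a + on_cycle s x b + on_cycle s x c = 2.
Proof.
move=> hs u3 nb; have := next_neq_prev x hs.
have : next s x \in [:: a; b; c].
  by apply/nb/(on_cycle_adj hs); rewrite on_cycleE // eqxx.
have : prev s x \in [:: a; b; c].
  by apply/nb/(on_cycle_adj hs); rewrite on_cycleE // eqxx orbT.
rewrite !on_cycleE //; move: u3; rewrite /= !inE !negb_or => /andP[/andP[ab ac] /andP[bc _]].
move: (next s x) (prev s x) => y z.
by case/or3P=> /eqP-> /or3P[]/eqP->; rewrite ?eqxx ?(negPf ab) ?(negPf ac) ?(negPf bc)
  1?eq_sym ?(negPf ab) ?(negPf ac) ?(negPf bc) //= ?(eq_sym b) ?(eq_sym c)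
  ?(negPf ab) ?(negPf ac) ?(negPf bc).
Qed.

Lemma on_cycle_connected s (A : pred G) x : ham_seq s -> A x ->
  (forall y z, A y -> on_cycle s y z -> A z) -> forall y, A y.
Proof.
move=> hs Ax cl y; have [/andP[_ us] s3 sT] := hs.
have /(nthP x)[i ilt ei] := sT x; have /(nthP x)[j jlt ej] := sT y.
have Am m : A (nth x s ((i + m) %% size s)).
  elim: m => [|m]; first by rewrite addn0 modn_small // ei.
  move/cl; apply; rewrite on_cycleE // next_nth_mod ?ltn_pmod //; last by lia.
  by rewrite -[(_ %% _).+1]addn1 modnDml addn1 addnS eqxx.
have := Am (j + (size s - i)); rewrite addnCA subnKC ?(ltnW ilt) // modnDr modn_small //.
by rewrite ej.
Qed.

Lemma edge_image_on_cycle (f : G -> G) s t : is_automorphism f -> ham_seq s -> ham_seq t ->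
  (forall x y, adj x y -> on_cycle s x y = on_cycle t (f x) (f y)) ->
  edge_image f (cycle_edges s) = cycle_edges t.
Proof.
move=> fA hs ht h; have [[g fK gK] fadj] := fA.
have nxt (r : seq G) x : ham_seq r -> on_cycle r x (next r x).
  by move=> hr; rewrite on_cycleE // eqxx.
apply/setP => e; apply/imsetP/idP.
  case=> _ /imsetP[x _ ->] ->; rewrite imsetU !imset_set1 -/(on_cycle t _ _) -h ?nxt //.
  exact: on_cycle_adj (nxt s x hs).
case/imsetP=> y _ ->; exists [set g y; g (next t y)].
  rewrite -/(on_cycle s _ _) h ?gK ?nxt // -fadj !gK.
  exact: on_cycle_adj (nxt t y ht).
by rewrite imsetU !imset_set1 !gK.
Qed.

Lemma on_cycle_map (f : G -> G) s x y : is_automorphism f -> ham_seq s ->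
  on_cycle (map f s) (f x) (f y) = on_cycle s x y.
Proof.
move=> fA hs; have fI := iso_inj fA; have [/andP[_ us] _ _] := hs.
rewrite !on_cycleE //; last exact: ham_seq_map.
by rewrite next_map ?prev_map // !(inj_eq fI).
Qed.

End CycleEdges.

Section PrismCycle.
Variable k : nat.
Hypothesis k3 : 3 <= k.
Local Notation H := (prism (cycle_graph k)).
Local Notation lev l i := (@level (cycle_graph k) l i).
Implicit Types (s : seq H) (i j : 'I_k) (l : 'I_2).

Lemma cycle_graph_adj i j :
  adj (i : cycle_graph k) j = (j == ordS i) || (i == ordS j).
Proof.
rewrite /= /cycle_adj; case: eqP => // <- /=; apply/esym/negbTE.
rewrite orbb -val_eqE /=; have := ltn_ord i.
have [e|h] : i.+1 = k \/ i.+1 < k by have := ltn_ord i; lia.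
  by rewrite e modnn; lia.
by rewrite modn_small; lia.
Qed.

Lemma ordS_neq i : (ordS i == i) = false.
Proof.
have := adj_irrefl (i : cycle_graph k); rewrite cycle_graph_adj orbb.
by rewrite eq_sym.
Qed.

Lemma ordSS_neq i : (ordS (ordS i) == i) = false.
Proof.
rewrite -val_eqE /= -[(_ %% _).+1]addn1 modnDml addn1; have := ltn_ord i.
by move=> ik; rewrite modn_lt2; [case: (ltnP i.+2); lia | lia].
Qed.

Definition horiz s l i := on_cycle s (lev l i) (lev l (ordS i)).
Definition rung s i := on_cycle s (lev ord0 i) (lev ord_max i).

Lemma level_cases l : l = ord0 \/ l = ord_max.
Proof. by case: l => [[|[|]]] // p; [left|right]; apply: val_inj. Qed.

Lemma lev_eq l l' i j : (lev l i == lev l' j) = (i == j) && (l == l').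
Proof. exact: xpair_eqE. Qed.

(** A vertex of the prism has degree three and the cycle uses two of its edges. Stating this at
    [ordS i] names both horizontal edges by their starting points. *)
Lemma prism_degree s l i : ham_seq s ->
  horiz s l (ordS i) + horiz s l i + rung s (ordS i) = 2.
Proof.
move=> hs.
have key l' : l != l' ->
    horiz s l (ordS i) + horiz s l i + on_cycle s (lev l (ordS i)) (lev l' (ordS i)) = 2.
  move=> ll'; rewrite /horiz [on_cycle _ (lev l i) _]on_cycle_sym.
  apply: cubic_degree hs _ _.
    by rewrite /= !inE !lev_eq (negPf ll') ordSS_neq ordS_neq !andbF.
  move=> [j l2]; rewrite adj_level -[(j, l2)]/(lev l2 j) !inE !lev_eq.
  rewrite (two_levels l2 ll') [l == l2]eq_sym.
  case: (l2 == l); rewrite [~~ _]/= ?andbT ?andbF ?orbF; last by rewrite eq_sym.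
  by rewrite cycle_graph_adj => /orP[->//|/eqP/ordS_inj->]; rewrite eqxx orbT.
case: (level_cases l) => e; subst l; first exact: key.
by rewrite -(key ord0) // /rung on_cycle_sym.
Qed.

Lemma iter_ordS m i : iter m (@ordS k) i = (i + m) %% k :> nat.
Proof.
elim: m => [|m IH]; first by rewrite addn0 modn_small.
by rewrite iterS /= IH -[(_ %% _).+1]addn1 modnDml addn1 addnS.
Qed.

Lemma iter_ordS_inj m : injective (iter m (@ordS k)).
Proof. by elim: m => // m IH x y /= /ordS_inj /IH. Qed.

Lemma ordS_ind (P : 'I_k -> Prop) i : P i -> (forall j, P j -> P (ordS j)) ->
  forall j, P j.
Proof.
move=> Pi PS j.
have iterP m : P (iter m (@ordS k) i) by elim: m => //= m; apply: PS.
rewrite (_ : j = iter (j + (k - i)) (@ordS k) i) //; apply: val_inj; rewrite /= iter_ordS.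
by rewrite addnCA subnKC ?modnDr ?modn_small // ltnW.
Qed.

(** The degree equations of the two ends of a rung share that rung, so agreement of the copies
    passes from one base edge to the next. *)
Lemma horiz_eq s i : ham_seq s -> horiz s ord0 i = horiz s ord_max i ->
  forall j, horiz s ord0 j = horiz s ord_max j.
Proof.
move=> hs e; apply: ordS_ind e _ => j e.
have := prism_degree ord0 j hs; have := prism_degree ord_max j hs; rewrite e.
by do 2!case: (horiz s _ (ordS j)); case: (horiz s _ j); case: (rung s _).
Qed.

(** A second gap would cut the base into two arcs with no cycle edge between the parts above them.
    Hence all other horizontal edges occur, and the degrees determine the rungs. *)
Lemma rungs_of_gap s j : ham_seq s -> ~~ horiz s ord0 j -> ~~ horiz s ord_max j ->
  (forall l i, horiz s l i = (i != j)) /\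
  (forall i, rung s i = (i == j) || (i == ordS j)).
Proof.
move=> hs h0 h1.
have heq : forall i, horiz s ord0 i = horiz s ord_max i.
  by apply: (horiz_eq (i := j)) => //; rewrite (negPf h0) (negPf h1).
have hl l i : horiz s l i = horiz s ord0 i.
  by case: (level_cases l) => ->.
(* [o] numbers the base vertices starting from [ordS j], so that [j] comes last and every step
   except the one across the gap increases it by one. *)
pose o (i : 'I_k) := (i + (k - j.+1)) %% k.
have jk := ltn_ord j.
have oj : o j = k.-1 by rewrite /o modn_small; lia.
have oS i : i != j -> o (ordS i) = (o i).+1.
  rewrite -val_eqE /= /o => ij; have ik := ltn_ord i.
  rewrite modnDml /= addSn modn_lt2 1?[(_ + _) %% _]modn_lt2; [|lia..].
  case: (ltnP (i + (k - j.+1)).+1 k) => a1; case: (ltnP (i + (k - j.+1)) k) => a2;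
    by move: ij; rewrite ?eqn_leq; lia.
have o_inj i i' : o i = o i' -> i = i'.
  rewrite /o !modn_lt2; [|have := ltn_ord i; have := ltn_ord i'; lia..].
  move=> e; apply: val_inj => /=; have := ltn_ord i; have := ltn_ord i'.
  by move: e; case: (ltnP (i + _)) => a1; case: (ltnP (i' + _)) => a2; lia.
have olt i : o i < k by rewrite ltn_pmod; lia.
have full i : i != j -> horiz s ord0 i.
  move=> ij; apply/negPn/negP => hi.
  have oij : o i < o j.
    have := olt i; rewrite oj => oik; have : o i <> k.-1; last by lia.
    by rewrite -oj => /o_inj e; rewrite e eqxx in ij.
  (* The part above the arc from [ordS j] to [i] would be closed under steps of the cycle, yet it
     misses [j]. *)
  suff cl (y z : H) : o y.1 <= o i -> on_cycle s y z -> o z.1 <= o i.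
    have := on_cycle_connected (x := lev ord0 i) hs (leqnn _) cl (lev ord0 j).
    by rewrite /= leqNgt oij.
  case: y z => [i1 l1] [i2 l2] le1 e12; have := on_cycle_adj hs e12.
  rewrite adj_level; case: eqP => [el|_ /eqP <- //]; subst l2.
  rewrite /= in le1; rewrite cycle_graph_adj; case/orP=> /eqP ei; subst.
    have i1i : i1 != i by apply: contraNneq hi => <-; rewrite -(hl l1).
    have i1j : i1 != j by apply: contraTneq le1 => ->; rewrite -ltnNge.
    rewrite oS // ltn_neqAle le1 andbT; apply: contraNneq i1i => /o_inj -> //.
  have i2j : i2 != j.
    by apply: contraNneq h0 => <-; rewrite -(hl l1) /horiz on_cycle_sym.
  by move: le1; rewrite oS // => /ltnW.
have hE l i : horiz s l i = (i != j).
  by rewrite hl; case: eqP => [->|/eqP/full]; rewrite ?(negPf h0).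
split=> // i; rewrite -(ord_predK i) (inj_eq (@ordS_inj _)).
move: (ord_pred i) => p; have := prism_degree ord0 p hs; rewrite !hE.
case: (p =P j) => [->|_]; first by rewrite ordS_neq; case: (rung s _).
by case: (ordS p == j); case: (rung s _).
Qed.

Lemma rung_exists s : ham_seq s -> exists i, rung s i.
Proof.
move=> hs; apply/existsP; rewrite -[[exists _, _]]negbK negb_exists.
apply/negP => /forallP nr.
have i0 : 'I_k by exists 0; apply: leq_trans k3.
suff cl (y z : H) : y.2 == ord0 -> on_cycle s y z -> z.2 == ord0.
  by have := on_cycle_connected (A := fun x : H => x.2 == ord0) (x := lev ord0 i0)
    hs (eqxx _) cl (lev ord_max i0).
case: y z => [i1 l1] [i2 l2] /= /eqP -> e12; have := on_cycle_adj hs e12.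
rewrite adj_level; case: eqP => [<- //|ne /eqP e]; subst i2.
have := nr i1; rewrite /rung; case: (level_cases l2) e12 ne => -> // e12 _.
by rewrite e12.
Qed.

(** Where a rung is missing, both copies use both horizontal edges, so they agree everywhere. Where
    a rung is present, one horizontal edge is missing, hence in both copies. *)
Lemma gap_exists s i : ham_seq s -> ~~ rung s i ->
  exists j, ~~ horiz s ord0 j && ~~ horiz s ord_max j.
Proof.
move=> hs ri; have heq : forall i, horiz s ord0 i = horiz s ord_max i.
  apply: (@horiz_eq _ i) => //; have := prism_degree ord0 (ord_pred i) hs.
  have := prism_degree ord_max (ord_pred i) hs; rewrite ord_predK (negPf ri).
  by do 2!case: (horiz s _ i); case: (horiz s _ (ord_pred i)) => //; case: (horiz s _ _).
suff [j hj] : exists j, ~~ horiz s ord0 j by exists j; rewrite -heq hj.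
have [j rj] := rung_exists hs; have := prism_degree ord0 (ord_pred j) hs.
rewrite ord_predK rj => d; case: (boolP (horiz s ord0 j)) => hj; last by exists j.
by exists (ord_pred j); move: d; rewrite hj; case: (horiz s _ _).
Qed.

Lemma iso_of_horiz_rung (f : H -> H) s t : is_automorphism f -> ham_seq s -> ham_seq t ->
    (forall l i, horiz s l i = on_cycle t (f (lev l i)) (f (lev l (ordS i)))) ->
    (forall i, rung s i = on_cycle t (f (lev ord0 i)) (f (lev ord_max i))) ->
  edge_image f (cycle_edges s) = cycle_edges t.
Proof.
move=> fA hs ht hh hr; apply: edge_image_on_cycle => // -[i1 l1] [i2 l2].
rewrite adj_level; case: eqP => [el|ne /eqP e].
  subst l2; rewrite cycle_graph_adj => /orP[/eqP->|/eqP->]; first exact: hh.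
  by rewrite on_cycle_sym (on_cycle_sym t); apply: hh.
subst i2; case: (level_cases l1) ne => ->; case: (level_cases l2) => -> // _.
  exact: hr.
by rewrite on_cycle_sym (on_cycle_sym t); apply: hr.
Qed.

Definition rotation m (x : H) : H := lev x.2 (iter m (@ordS k) x.1).

Lemma rotation_automorphism m : is_automorphism (rotation m).
Proof.
have iS := @iter_ordS_inj m.
split.
  apply: injF_bij => -[i1 l1] [i2 l2] [/iS -> ->] //.
move=> [i1 l1] [i2 l2]; rewrite !adj_level (inj_eq iS).
by rewrite !cycle_graph_adj -!iterS !iterSr !(inj_eq iS).
Qed.

(** By [rungs_of_gap] a gap determines the whole cycle, so rotating one gap onto the other
    suffices. *)
Lemma rotation_gap s t j j' : ham_seq s -> ham_seq t ->
    ~~ horiz s ord0 j -> ~~ horiz s ord_max j ->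
    ~~ horiz t ord0 j' -> ~~ horiz t ord_max j' ->
  exists f : H -> H, is_automorphism f /\ edge_image f (cycle_edges s) = cycle_edges t.
Proof.
move=> hs ht s0 s1 t0 t1.
have [m em] : exists m, iter m (@ordS k) j = j'.
  by apply: (@ordS_ind (fun j' => exists m, iter m (@ordS k) j = j') j);
    [exists 0|move=> i [m <-]; exists m.+1].
have [shE srE] := rungs_of_gap hs s0 s1; have [thE trE] := rungs_of_gap ht t0 t1.
have iS := @iter_ordS_inj m.
exists (rotation m); split; first exact: rotation_automorphism.
apply: iso_of_horiz_rung => // [|l i|i]; first exact: rotation_automorphism.
  rewrite shE /rotation /= -iterSr iterS; have := thE l (iter m (@ordS k) i).
  by rewrite -em (inj_eq iS) => <-.
rewrite srE /rotation /=; have := trE (iter m (@ordS k) i).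
by rewrite -em -iterS iterSr !(inj_eq iS) => <-.
Qed.

(** If all rungs were used, the horizontal edges of a copy would be alternately present and absent,
    which is impossible around an odd cycle. *)
Lemma odd_gap s : odd k -> ham_seq s -> exists j, ~~ horiz s ord0 j && ~~ horiz s ord_max j.
Proof.
move=> ok hs; case: (boolP [exists i, ~~ rung s i]) => [/existsP[i ri]|].
  exact: gap_exists ri.
rewrite negb_exists => /forallP ar.
have i0 : 'I_k by exists 0; apply: leq_trans k3.
have alt i : horiz s ord0 (ordS i) = ~~ horiz s ord0 i.
  have := prism_degree ord0 i hs; have := ar (ordS i); rewrite negbK => ->.
  by case: (horiz s _ (ordS i)); case: (horiz s _ i).
have altm m : horiz s ord0 (iter m (@ordS k) i0) = odd m (+) horiz s ord0 i0.
  by elim: m => //= m IH; rewrite alt IH addNb.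
have := altm k; have -> : iter k (@ordS k) i0 = i0.
  by apply: val_inj; rewrite /= iter_ordS modnDr modn_small.
by rewrite ok; case: (horiz _ _ _).
Qed.

End PrismCycle.

Lemma prism_odd_cycle_transitive k (s t : seq (prism (cycle_graph k))) :
  3 <= k -> odd k -> ham_seq s -> ham_seq t ->
  exists f : prism (cycle_graph k) -> prism (cycle_graph k),
    is_automorphism f /\ edge_image f (cycle_edges s) = cycle_edges t.
Proof.
move=> k3 ok hs ht.
have [i /andP[s0 s1]] := odd_gap k3 ok hs; have [j /andP[t0 t1]] := odd_gap k3 ok ht.
exact: rotation_gap s0 s1 t0 t1.
Qed.

(** * Transfer along isomorphisms, and the square *)

Lemma edge_image_comp (G H K : sgraph) (f : G -> H) (g : H -> K) (C : {set {set G}}) :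
  edge_image (g \o f) C = edge_image g (edge_image f C).
Proof.
rewrite /edge_image -imset_comp; apply: eq_imset => e /=.
by rewrite -imset_comp.
Qed.

Lemma edge_image_can (G H : sgraph) (f : G -> H) (g : H -> G) (C : {set {set G}}) :
  cancel f g -> edge_image g (edge_image f C) = C.
Proof.
move=> fK; rewrite -edge_image_comp /edge_image -[RHS]imset_id.
by apply: eq_imset => e; rewrite -[RHS]imset_id; apply: eq_imset => x /=; rewrite fK.
Qed.

Lemma iso_comp (G H K : sgraph) (f : G -> H) (g : H -> K) :
  is_isomorphism f -> is_isomorphism g -> is_isomorphism (g \o f).
Proof. by case=> bf af [bg ag]; split=> [|x y]; [apply: bij_comp|rewrite /= ag]. Qed.

Lemma iso_inv (G H : sgraph) (f : G -> H) : is_isomorphism f ->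
  exists g : H -> G, [/\ is_isomorphism g, cancel f g & cancel g f].
Proof.
case=> -[g fK gK] af; exists g; split=> //; split=> [|x y]; first by exists f.
by rewrite -af !gK.
Qed.

Lemma isomorphic_sym (G H : sgraph) : isomorphic G H -> isomorphic H G.
Proof. by case=> f /iso_inv[g [gi _ _]]; exists g. Qed.

Lemma isomorphic_prism (G H : sgraph) : isomorphic G H -> isomorphic (prism G) (prism H).
Proof.
case=> f fi; have [g [gi fK gK]] := iso_inv fi.
exists (fun x => level x.2 (f x.1)); split.
  exists (fun y => level y.2 (g y.1)) => -[x l]; by rewrite /level /= ?fK ?gK.
move=> [x l] [y l']; rewrite !adj_level (inj_eq (iso_inj fi)).
by case: fi => _ ->.
Qed.

Lemma hamiltonian_iso (G H : sgraph) : isomorphic G H -> hamiltonian G -> hamiltonian H.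
Proof.
move=> [f fi] [C [s [cs s3 sT _]]]; exists (cycle_edges (map f s)).
by apply/ham_seq_cycle/(ham_seq_map fi).
Qed.

Lemma hamiltonian_prism (G : sgraph) : hamiltonian G -> hamiltonian (prism G).
Proof.
case=> C [s [cs s3 sT _]]; have hs : ham_path s by apply: ham_seq_path.
have x0 : G by case: (s) s3.
exists (cycle_edges (fold_seq ord0 ord_max s s)); apply: ham_seq_cycle.
by apply: (ham_fold_seq (x0 := x0)) => //; lia.
Qed.

Lemma hamiltonian_transitive_of_seq (G : sgraph) : hamiltonian G ->
    (forall s t : seq G, ham_seq s -> ham_seq t ->
      exists f : G -> G, is_automorphism f /\ edge_image f (cycle_edges s) = cycle_edges t) ->
  hamiltonian_transitive G.
Proof.
move=> hG h; split=> // C D [s [cs s3 sT ->]] [t [ct t3 tT ->]].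
exact: h.
Qed.

(** Automorphisms are conjugated by the isomorphism. *)
Lemma hamiltonian_transitive_iso (G H : sgraph) : isomorphic G H ->
  hamiltonian_transitive H -> hamiltonian_transitive G.
Proof.
move=> GH [hH tr]; have [f fi] := GH; have [g [gi fK gK]] := iso_inv fi.
apply: hamiltonian_transitive_of_seq => [|s t hs ht].
  exact: hamiltonian_iso (isomorphic_sym GH) hH.
have [h [hA e]] := tr _ _ (ham_seq_cycle (ham_seq_map fi hs)) (ham_seq_cycle (ham_seq_map fi ht)).
exists (g \o (h \o f)); split; first by apply: iso_comp => //; apply: iso_comp.
have im r : ham_seq r -> cycle_edges (map f r) = edge_image f (cycle_edges r).
  by move=> [/andP[_ ur] _ _]; rewrite edge_image_cycle_edges //; apply: iso_inj.
move: e; rewrite (im s hs) (im t ht) => e.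
by apply: (etrans (edge_image_comp _ _ _)); rewrite edge_image_comp e edge_image_can.
Qed.

(* Writing the vertices of the 4-cycle as [0 = 00, 1 = 10, 2 = 11, 3 = 01], the prism
   is the 3-cube and this map exchanges its first and last coordinates. *)
Definition cube_swap (x : prism (cycle_graph 4)) : prism (cycle_graph 4) :=
  (inord (if 2 <= x.1 then 3 - x.2 else x.2), inord ((x.1 == 1 :> nat) || (x.1 == 2 :> nat))).

Lemma cube_swap1 x :
  (cube_swap x).1 = (if 2 <= x.1 then 3 - x.2 else x.2) :> nat.
Proof. by case: x => [[i ip] [l lp]] /=; rewrite inordK //; case: ifP; lia. Qed.

Lemma cube_swap2 x :
  (cube_swap x).2 = ((x.1 == 1 :> nat) || (x.1 == 2 :> nat)) :> nat.
Proof. by case: x => [[i ip] [l lp]] /=; rewrite inordK //; case: (_ || _). Qed.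

Lemma cube_swapK : involutive cube_swap.
Proof.
move=> x; have e1 := cube_swap1 (cube_swap x); have e2 := cube_swap2 (cube_swap x).
rewrite (surjective_pairing (cube_swap _)) [RHS]surjective_pairing.
congr (_, _); apply: val_inj; [apply: (etrans e1)|apply: (etrans e2)]; rewrite cube_swap1 ?cube_swap2;
case: x {e1 e2} => [[i ip] [l lp]] /=;
by case: i l ip lp => [|[|[|[|i]]]] [|[|l]].
Qed.

Lemma cube_swap_automorphism : is_automorphism cube_swap.
Proof.
split; first exact: inv_bij cube_swapK.
have adjE x y : adj (x : prism (cycle_graph 4)) y =
    if (x.2 == y.2 :> nat) then (y.1 == x.1.+1 %% 4 :> nat) || (x.1 == y.1.+1 %% 4 :> nat)
    else (x.1 == y.1 :> nat).
  by case: x y => [x1 x2] [y1 y2]; rewrite adj_level -val_eqE; case: ifP => _;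
    rewrite ?cycle_graph_adj.
move=> x y; rewrite !adjE !cube_swap1 !cube_swap2.
case: x y => [[i ip] [l lp]] [[j jp] [m mp]] /=.
by case: i l ip lp => [|[|[|[|i]]]] [|[|l]] // _ _; case: j m jp mp => [|[|[|[|j]]]] [|[|m]].
Qed.

(** A missing rung already gives a gap. With all rungs present each copy contains two opposite edges
    of the square, and [cube_swap] is applied when these do not leave a common gap. *)
Lemma prism_square_gap (s : seq (prism (cycle_graph 4))) : ham_seq s ->
  exists f : prism (cycle_graph 4) -> prism (cycle_graph 4), is_automorphism f /\
    exists j, ~~ horiz (map f s) ord0 j && ~~ horiz (map f s) ord_max j.
Proof.
move=> hs; have k3 : 3 <= 4 by [].
have noswap : (exists j, ~~ horiz s ord0 j && ~~ horiz s ord_max j) ->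
    exists f : prism (cycle_graph 4) -> prism (cycle_graph 4), is_automorphism f /\
    exists j, ~~ horiz (map f s) ord0 j && ~~ horiz (map f s) ord_max j.
  by move=> gap; exists id; rewrite map_id; split=> //; split=> //; exists id.
case: (boolP [forall i, rung s i]) => [/forallP ar|]; last first.
  by rewrite negb_forall => /existsP[i ri]; apply/noswap/(gap_exists k3 hs ri).
have alt l i : horiz s l (ordS i) = ~~ horiz s l i.
  have := prism_degree k3 l i hs; rewrite ar.
  by case: (horiz s _ (ordS i)); case: (horiz s _ i).
pose o i : 'I_4 := inord i.
have oS i : i < 4 -> ordS (o i) = o (i.+1 %% 4).
  by move=> i4; apply: val_inj; rewrite /= !inordK // ltn_pmod.
(* Either copy [l] uses the edge at [o 0], and so lacks those at [o 1] and [o 3], or the copies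
   agree, and so share a gap at [o 0] or just after it. *)
have [l hl] : exists l, horiz s l (o 0) || (horiz s ord0 (o 0) == horiz s ord_max (o 0)).
  case: (boolP (horiz s ord0 (o 0))) => h0; first by exists ord0; rewrite h0.
  by exists ord_max; case: (horiz s ord_max _).
case/orP: hl => [hl|/eqP e]; last first.
  have heq := horiz_eq k3 hs e; apply: noswap.
  case: (boolP (horiz s ord0 (o 0))) => h0.
    by exists (ordS (o 0)); rewrite -heq alt h0.
  by exists (o 0); rewrite -heq h0.
have h1 : horiz s l (o 1) = false by have := alt l (o 0); rewrite (oS 0 isT) hl.
have h3 : horiz s l (o 3) = false.
  by have := alt l (o 3); rewrite (oS 3 isT) [_ %% _]/= hl => /esym/negbTE.
exists cube_swap; split; first exact: cube_swap_automorphism.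
have swE (l' : 'I_2) i : i < 4 -> cube_swap (level l' (o i : cycle_graph 4)) =
    level (inord ((i == 1) || (i == 2))) (o (if 2 <= i then 3 - l' else l') : cycle_graph 4).
  by move=> i4; rewrite /cube_swap /level /= /o !inordK.
have sw l' i : i < 4 -> horiz (map cube_swap s) l' (o i) =
    on_cycle s (cube_swap (level l' (o i : cycle_graph 4)))
               (cube_swap (level l' (o (i.+1 %% 4) : cycle_graph 4))).
  move=> i4; rewrite -(on_cycle_map _ _ cube_swap_automorphism hs) !cube_swapK.
  by rewrite /horiz oS.
(* The absent edges at [o 1] and [o 3] of copy [l] are parallel in the cube. The swap makes them the
   two copies of one base edge, the one at [o 3] or at [o 1] according to [l]. *)
exists (if l == ord0 then o 3 else o 1).
have l0 : inord 0 = ord0 :> 'I_2 by apply: val_inj; rewrite /= inordK.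
have l1 : inord 1 = ord_max :> 'I_2 by apply: val_inj; rewrite /= inordK.
have modE : (1 %% 4 = 1) * (2 %% 4 = 2) * (3 %% 4 = 3) * (4 %% 4 = 0) by [].
rewrite /horiz !oS // !modE in h1 h3.
case: (level_cases l) h1 h3 => -> h1 h3; rewrite ?eqxx; rewrite !sw // !swE // !modE /= ?l0 ?l1.
  by rewrite (_ : 3 - 0 = 3) 1?(_ : 3 - 1 = 2) ?h3 1?on_cycle_sym ?h1.
by rewrite (_ : 3 - 0 = 3) 1?(_ : 3 - 1 = 2) 1?on_cycle_sym ?h3 ?h1.
Qed.

(** Both cycles are first moved to cycles with a gap, and these are matched by a rotation. *)
Lemma prism_square_transitive (s t : seq (prism (cycle_graph 4))) :
  ham_seq s -> ham_seq t ->
  exists f : prism (cycle_graph 4) -> prism (cycle_graph 4),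
    is_automorphism f /\ edge_image f (cycle_edges s) = cycle_edges t.
Proof.
move=> hs ht.
have [f [fA [i /andP[s0 s1]]]] := prism_square_gap hs.
have [g [gA [j /andP[t0 t1]]]] := prism_square_gap ht.
have [h [hA e]] := rotation_gap (isT : 3 <= 4) (ham_seq_map fA hs) (ham_seq_map gA ht) s0 s1 t0 t1.
have [g' [gA' gK _]] := iso_inv gA.
exists (g' \o (h \o f)); split; first by apply: iso_comp => //; apply: iso_comp.
have [/andP[_ us] _ _] := hs; have [/andP[_ ut] _ _] := ht.
move: e; rewrite -(edge_image_cycle_edges (iso_inj fA) us).
rewrite -(edge_image_cycle_edges (iso_inj gA) ut) => e.
apply: (etrans (edge_image_comp _ _ _)); rewrite edge_image_comp e.
exact: edge_image_can.
Qed.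

Theorem theorem8 (G : sgraph) (hG : hamiltonian G) :
  hamiltonian_transitive (cart_prod G (complete_graph 2)) <->
  (exists k : nat, [/\ 3 <= k, odd k & isomorphic G (cycle_graph k)]) \/
  isomorphic G (cycle_graph 4).
Proof.
split=> [tr|].
  have [C [v [cv v3 vT _]]] := hG; have hv : ham_seq v by split.
  have iso := chordless_iso hv tr; case: (boolP (odd (size v))) => ov.
    by left; exists (size v).
  have e4 : size v = 4 by have := ham_seq_even_le4 hv tr ov; lia.
  by right; rewrite -e4.
case=> [[k [k3 ok iso]]|iso].
  apply: hamiltonian_transitive_iso (isomorphic_prism iso) _.
  apply: hamiltonian_transitive_of_seq; last by move=> s t; apply: prism_odd_cycle_transitive.
  exact/hamiltonian_prism/(hamiltonian_iso iso).
apply: hamiltonian_transitive_iso (isomorphic_prism iso) _.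
apply: hamiltonian_transitive_of_seq; last exact: prism_square_transitive.
exact/hamiltonian_prism/(hamiltonian_iso iso).
Qed.
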